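(* For each hypergraph $\mathcal{H}$ in $\mathcal{M}\cup\mathcal{F}$ (that is, $\mathcal{H}=M_n$ or $\mathcal{H}=F_n$ for some integer $n\ge 1$), there exists a doubly partial order whose competition hypergraph contains $\mathcal{H}$ as a subhypergraph.
   Context: For $x=(x_1,x_2), y=(y_1,y_2)\in\mathbb{R}^2$ write $x\prec y$ if $x_1<y_1$ and $x_2<y_2$. A digraph $D$ with vertex set $V(D)$ and arc set $A(D)$ is a doubly partial order (DPO) if there exist a finite subset $V\subset\mathbb{R}^2$ and a bijection $\phi:V(D)\to V$ such that $A(D)=\{(x,y)\mid x,y\in V(D),\ \phi(y)\prec\phi(x)\}$. The in-neighborhood of $v$ is $N_D^-(v)=\{u\in V(D)\mid (u,v)\in A(D)\}$. All hypergraphs have no loops (every hyperedge has at least two vertices) and no multiple hyperedges (the hyperedges form a set of subsets of the vertex set). The competition hypergraph $C\mathcal{H}(D)$ of a digraph $D$ is the hypergraph with vertex set $V(D)$ in which $e\subseteq V(D)$ is a hyperedge if and only if $|e|\ge 2$ and $e=N_D^-(v)$ for some vertex $v$ of $D$. A subhypergraph of a hypergraph $\mathcal{H}$ is a hypergraph $\mathcal{H}'$ with $V(\mathcal{H}')\subseteq V(\mathcal{H})$ and $E(\mathcal{H}')=\{e\cap V(\mathcal{H}')\mid e\in E(\mathcal{H}),\ |e\cap V(\mathcal{H}')|\ge 2\}$. ''Contains as a subhypergraph'' is understood up to isomorphism. For a positive integer $n$, $M_n$ and $F_n$ are the hypergraphs on the vertex set $V=\{v_1,\dots,v_{n+3}\}$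 ($n+3$ vertices) with $E(M_n)=\{\{v_i,v_{i+1}\}\mid 1\le i\le n+1\}\cup\{V\setminus\{v_1,v_{n+2}\}\}$ and $E(F_n)=\{\{v_i,v_{i+1}\}\mid 1\le i\le n+1\}\cup\{V\setminus\{v_1\},\,V\setminus\{v_{n+2}\}\}$. Set $\mathcal{M}=\{M_n\mid n\ge 1\}$ and $\mathcal{F}=\{F_n\mid n\ge 1\}$. *)

(* Defs.v *)
From mathcomp Require Import all_boot all_algebra.
From mathcomp Require Import boolp classical_sets functions cardinality reals.

Set Implicit Arguments.
Unset Strict Implicit.
Unset Printing Implicit Defensive.

Definition prec (R : realType) (x y : R * R) : Prop :=
  (x.1 < y.1)%R /\ (x.2 < y.2)%R.

(* A digraph on the vertex set T is given by its arc relation D : rel T. *)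
Definition is_DPO (R : realType) (T : finType) (D : rel T) : Prop :=
  exists (V : classical_sets.set (R * R)) (phi : T -> R * R),
    [/\ finite_set V,
        set_bij [set: T]%classic V phi &
        forall x y : T, D x y <-> prec (phi y) (phi x)].

Definition in_neighborhood (T : finType) (D : rel T) (v : T) : {set T} :=
  [set u | D u v].

(* T is only an ambient type: the vertex set is hverts, possibly smaller than  *)
(* T, so that a hypergraph and its subhypergraphs live over the same T.        *)
Record hypergraph (T : finType) := Hypergraph {
  hverts : {set T};
  hedges : {set {set T}};
  hedges_sub : forall e, e \in hedges -> e \subset hverts;
  hedges_loopless : forall e, e \in hedges -> 1 < #|e|
}.

Definition is_subhypergraph (T : finType) (H' H : hypergraph T) : Prop :=
  hverts H' \subset hverts H /\
  hedges H' = [set e :&: hverts H' | e in hedges H & 1 < #|e :&: hverts H'|].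

(* The values of f outside hverts H are irrelevant. *)
Definition hypergraph_iso (T U : finType) (H : hypergraph T) (K : hypergraph U)
    : Prop :=
  exists f : T -> U,
    [/\ {in hverts H &, injective f},
        f @: hverts H = hverts K &
        [set f @: (e : {set T}) | e in hedges H] = hedges K].

Definition contains_subhypergraph (T U : finType)
    (H : hypergraph T) (K : hypergraph U) : Prop :=
  exists H' : hypergraph T, is_subhypergraph H' H /\ hypergraph_iso H' K.

Section CompetitionHypergraph.
Variables (T : finType) (D : rel T).

Definition competition_edges : {set {set T}} :=
  [set e : {set T} | (1 < #|e|) && [exists v, e == in_neighborhood D v]].

Fact competition_edges_sub e : e \in competition_edges -> e \subset [set: T].
Proof. by move=> _; apply: finset.subsetT. Qed.

Fact competition_edges_loopless e : e \in competition_edges -> 1 < #|e|.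
Proof. by rewrite inE => /andP[]. Qed.

Definition competition_hypergraph : hypergraph T :=
  Hypergraph competition_edges_sub competition_edges_loopless.

End CompetitionHypergraph.

Section Families.
Variable n : nat.

(* Indices are those of the mathematical text, 1 <= i <= n + 3: the vertex     *)
(* v_i is the ordinal i - 1.                                                   *)
Definition vtx (i : nat) : 'I_n.+3 := inord i.-1.

(* The pairs {v_i, v_(i+1)} with 1 <= i <= n + 1; the bound variable below     *)
(* is i - 1.                                                                   *)
Definition path_edges : {set {set 'I_n.+3}} :=
  [set [set vtx k.+1; vtx k.+2] | k : 'I_n.+1].

Definition M_edges : {set {set 'I_n.+3}} :=
  path_edges :|: [set [set: 'I_n.+3] :\: [set vtx 1; vtx n.+2]].

Definition F_edges : {set {set 'I_n.+3}} :=
  path_edges :|: [set [set: 'I_n.+3] :\ vtx 1; [set: 'I_n.+3] :\ vtx n.+2].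

Fact path_edges_loopless e : e \in path_edges -> 1 < #|e|.
Proof.
case/imsetP=> k _ ->; rewrite cards2 /vtx /=.
suff -> : (inord k : 'I_n.+3) != inord k.+1 by [].
have hk : k < n.+2 := ltn_trans (ltn_ord k) (ltnSn _).
by rewrite -val_eqE /= !inordK ?neq_ltn ?ltnSn // ltnW.
Qed.

Fact M_edges_sub e : e \in M_edges -> e \subset [set: 'I_n.+3].
Proof. by move=> _; apply: finset.subsetT. Qed.

Fact M_edges_loopless (n_gt0 : 0 < n) e : e \in M_edges -> 1 < #|e|.
Proof.
rewrite finset.in_setU => /orP[/path_edges_loopless //|/set1P ->].
have := cardsCs ([set: 'I_n.+3] :\: [set vtx 1; vtx n.+2]).
rewrite finset.setTD finset.setCK cards2 card_ord => ->.
by case: (_ != _); rewrite ?subn2 ?subn1 /= ?ltnS.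
Qed.

Fact F_edges_sub e : e \in F_edges -> e \subset [set: 'I_n.+3].
Proof. by move=> _; apply: finset.subsetT. Qed.

Fact F_edges_loopless e : e \in F_edges -> 1 < #|e|.
Proof.
rewrite finset.in_setU => /orP[/path_edges_loopless //|/set2P[] ->].
- have := cardsD1 (vtx 1) [set: 'I_n.+3].
  by rewrite finset.in_setT cardsT card_ord add1n => -[<-].
- have := cardsD1 (vtx n.+2) [set: 'I_n.+3].
  by rewrite finset.in_setT cardsT card_ord add1n => -[<-].
Qed.

(* For n = 0 the set V \ {v_1, v_2} would be a loop.                            *)
Definition M_hypergraph (n_gt0 : 0 < n) : hypergraph 'I_n.+3 :=
  Hypergraph M_edges_sub (M_edges_loopless n_gt0).

Definition F_hypergraph : hypergraph 'I_n.+3 :=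
  Hypergraph F_edges_sub F_edges_loopless.

End Families.

(* Main.v *)
Require Import Defs.
From mathcomp Require Import classical_sets functions cardinality.
From mathcomp Require Import all_boot all_algebra reals zify.

(** Draw every vertex of the hypergraph as a lattice point and add, for every
hyperedge, one further point (a witness) such that the drawn vertices strictly
above it are exactly those of the hyperedge.  Both kinds of points together form a doubly
partial order.  Its competition hypergraph, traced on the drawn vertices, has
the wanted hyperedges together with the sets of at least two drawn vertices
that lie above a single drawn vertex; the drawing is therefore correct as soon
as no drawn vertex lies below two others ([drawing_realizes]).

The path [v_1, ..., v_(n+2)] is drawn on the antidiagonal, as the points
[(4k, -4k)] for [k = 0, ..., n+1].  Here the points above a witness always form
an interval of the path, and every interval arises.  The last vertex
[v_(n+3)], the apex, has to lie in the large hyperedges and in no pair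
[{v_i, v_(i+1)}].  It must not lie far below the antidiagonal either, since
then it would itself be below several path vertices.  Both demands are met
by placing it just below [v_2], at [(4, -4) - (1, 1)], and by pushing the
witness of each pair so close to its two vertices that one of its coordinates
is at least that of the apex.  The witnesses of the large hyperedges are left
as low as their interval allows, and so are below the apex. *)

Set Implicit Arguments.
Unset Strict Implicit.
Unset Printing Implicit Defensive.

Import Num.Theory.

(** * Realizing a hypergraph by a drawing with witnesses *)

Definition below (p q : int * int) : bool := ((p.1 < q.1) && (p.2 < q.2))%R.

Definition above (U : finType) (P : U -> int * int) (w : int * int) : {set U} :=
  [set u | below w (P u)].

Definition points_digraph (s : seq (int * int)) : rel (seq_sub s) :=
  fun x y => below (ssval y) (ssval x).

(** Indexing the vertices by the points themselves makes the embedding into the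
plane injective whether or not the list has repetitions. *)
Lemma points_digraph_DPO (R : realType) (s : seq (int * int)) :
  is_DPO R (@points_digraph s).
Proof.
pose phi (x : seq_sub s) : R * R :=
  (((ssval x).1)%:~R, ((ssval x).2)%:~R)%R.
exists (phi @` [set: seq_sub s])%classic, phi; split.
- exact/finite_image/finite_finset.
- apply: inj_bij => x y _ _ [/eqP + /eqP].
  rewrite !eqr_int => /eqP e1 /eqP e2.
  apply: val_inj => /=; move: e1 e2.
  by case: (ssval x) (ssval y) => a b [c d] /= -> ->.
- move=> x y; rewrite /prec /= !ltr_int /points_digraph /below.
  by split=> [/andP|/andP].
Qed.

(** A drawn vertex is itself a potential witness; the bound on [#|above P (P u)|]
ensures that it contributes only a set too small to be a hyperedge. *)
Lemma drawing_realizes (R : realType) (U : finType) (u0 : U) (K : hypergraph U)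
    (P : U -> int * int) (W : seq (int * int)) :
  injective P -> hverts K = [set: U] ->
  (forall u, #|above P (P u)| <= 1) ->
  hedges K =i [seq above P w | w <- W] ->
  exists (T : finType) (D : rel T),
    is_DPO R D /\ contains_subhypergraph (competition_hypergraph D) K.
Proof.
move=> injP vK sparse eK; pose s := codom P ++ W.
exists (seq_sub s), (@points_digraph s); split; first exact: points_digraph_DPO.
have Ps u : P u \in s by rewrite mem_cat codom_f.
pose emb u : seq_sub s := SeqSub (Ps u).
have emb_inj : injective emb by move=> u v [/injP].
pose f (x : seq_sub s) := odflt u0 [pick u | emb u == x].
have embK : cancel emb f.
  move=> u; rewrite /f; case: pickP => [v /eqP/emb_inj //|/(_ u)].
  by rewrite eqxx.
pose S := emb @: [set: U].
have traceE v : in_neighborhood (@points_digraph s) v :&: S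
              = emb @: above P (ssval v).
  apply/setP=> x; apply/setIP/imsetP => [[+ /imsetP[u _ xE]]|[u uw ->]].
    by rewrite xE inE => uw; exists u; rewrite // inE.
  by split; [move: uw; rewrite !inE | rewrite imset_f ?inE].
pose CE := competition_edges (@points_digraph s).
pose E := [set e :&: S | e in CE & 1 < #|e :&: S|].
have Esub e : e \in E -> e \subset S.
  by case/imsetP=> e' _ ->; apply: subsetIr.
have Eloop e : e \in E -> 1 < #|e|.
  by case/imsetP=> e'; rewrite inE => /andP[_ ?] ->.
have EP (A : {set U}) : (emb @: A \in E) = (A \in hedges K).
  apply/idP/idP => [/imsetP[e]|AK].
    rewrite !inE => /andP[/andP[_ /existsP[v /eqP ->]]].
    rewrite traceE card_imset // => cardv /(imset_inj emb_inj) ->.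
    have := ssvalP v; rewrite mem_cat => /orP[/codomP[u vE]|vW].
      by have := sparse u; rewrite -vE leqNgt cardv.
    by rewrite eK map_f.
  have cardA := hedges_loopless AK.
  move: AK; rewrite eK => /mapP[w wW AE].
  have ws : w \in s by rewrite mem_cat wW orbT.
  pose v : seq_sub s := SeqSub ws.
  have trA : in_neighborhood (@points_digraph s) v :&: S = emb @: A.
    by rewrite traceE AE.
  apply/imsetP; exists (in_neighborhood (@points_digraph s) v) => //.
  rewrite !inE trA card_imset // cardA andbT.
  apply/andP; split; last by apply/existsP; exists v.
  apply: leq_trans (subset_leq_card (subsetIl _ S)).
  by rewrite trA card_imset.
have fembK (A : {set U}) : f @: (emb @: A) = A.
  rewrite -imset_comp -[RHS]imset_id.
  by apply: eq_imset => u /=; rewrite embK.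
exists (Hypergraph Esub Eloop); split; first by split=> //; apply: subsetT.
exists f; split=> /=.
- by move=> _ _ /imsetP[u _ ->] /imsetP[v _ ->]; rewrite !embK => ->.
- by rewrite vK fembK.
apply/setP=> A; apply/imsetP/idP => [[e eE ->]|AK].
  case/imsetP: (eE) => e'; rewrite !inE => /andP[/andP[_ /existsP[v /eqP ->]] _].
  by rewrite traceE => eE'; move: eE; rewrite eE' EP fembK.
by exists (emb @: A); rewrite ?EP ?fembK.
Qed.

(** * Drawing the path and the apex *)

Section Drawing.
Variable n : nat.

Definition draw (j : 'I_n.+3) : int * int :=
  (if j == n.+2 :> nat then (3, -5) else (4 * j%:Z, - (4 * j%:Z)))%R.

Definition pair_witness (k : 'I_n.+1) : int * int :=
  (4 * k%:Z - 1, - (4 * k%:Z) - 5)%R.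

(** The coordinates of the apex are not multiples of 4. *)
Lemma draw_inj : injective draw.
Proof.
move=> i j /(congr1 fst); rewrite /draw => Eij; apply: val_inj; move: Eij.
by do 2![case: eqP => ?] => /=; lia.
Qed.

Lemma mem_above_draw w (j : 'I_n.+3) : (j \in above draw w) =
  if j == n.+2 :> nat then ((w.1 < 3) && (w.2 < -5))%R
  else ((w.1 < 4 * j%:Z) && (w.2 < - (4 * j%:Z)))%R.
Proof. by rewrite inE /below /draw; case: ifP. Qed.

Lemma eq_vtx (j : 'I_n.+3) k : k < n.+3 -> (j == vtx n k.+1) = (j == k :> nat).
Proof. by move=> lt_kn; rewrite -val_eqE /= inordK. Qed.

(** The apex is below [v_2] alone, and the path is an antichain that nowhere
passes below the apex. *)
Lemma above_draw_sparse j : #|above draw (draw j)| <= 1.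
Proof.
rewrite -(cards1 (vtx n 2)); apply: subset_leq_card; apply/subsetP => i.
rewrite mem_above_draw inE eq_vtx // /draw.
by do 2![case: eqP => ?] => /=; lia.
Qed.

(** On the path the witness selects the interval [k, k+1].  The apex [(3, -5)]
escapes by its second coordinate if [k = 0] and by its first coordinate if
[k > 0]. *)
Lemma above_pair_witness (k : 'I_n.+1) :
  above draw (pair_witness k) = [set vtx n k.+1; vtx n k.+2].
Proof.
have lt_kn := ltn_ord k.
apply/setP=> j; rewrite mem_above_draw !inE /= !eq_vtx; try lia.
by case: eqP => ?; lia.
Qed.

Lemma path_edgesE :
  path_edges n =i [seq above draw w | w <- codom pair_witness].
Proof.
move=> e; apply/imsetP/mapP => [[k _ ->]|[w /codomP[k ->] ->]].
  by exists (pair_witness k); rewrite ?codom_f ?above_pair_witness.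
by exists k; rewrite ?above_pair_witness.
Qed.

(** A witness on the vertical line [x = 0] through [v_1] excludes [v_1], and one
on the horizontal line [y = -4(n+1)] through [v_(n+2)] excludes [v_(n+2)].  The
inner hyperedge takes its witness on both lines.  A hyperedge that omits only
one end of the path takes it on one of them, with the other coordinate lowered
by one step of the path. *)
Lemma above_inner : 0 < n ->
  above draw (0, - (4 * n.+1%:Z))%R
  = [set: 'I_n.+3] :\: [set vtx n 1; vtx n n.+2].
Proof.
move=> n_gt0; apply/setP=> j; have lt_jn := ltn_ord j.
rewrite mem_above_draw !inE /= !eq_vtx; try lia.
by case: eqP => ?; lia.
Qed.

Lemma above_all_but_first :
  above draw (0, - (4 * n.+2%:Z))%R = [set: 'I_n.+3] :\ vtx n 1.
Proof.
apply/setP=> j; have lt_jn := ltn_ord j.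
rewrite mem_above_draw !inE /= !eq_vtx; try lia.
by case: eqP => ?; lia.
Qed.

Lemma above_all_but_last : 0 < n ->
  above draw (-4, - (4 * n.+1%:Z))%R = [set: 'I_n.+3] :\ vtx n n.+2.
Proof.
move=> n_gt0; apply/setP=> j; have lt_jn := ltn_ord j.
rewrite mem_above_draw !inE /= !eq_vtx; try lia.
by case: eqP => ?; lia.
Qed.

End Drawing.

Theorem theorem9 (R : realType) (n : nat) (n_gt0 : 0 < n)
    (H : hypergraph 'I_n.+3) :
  H = M_hypergraph n_gt0 \/ H = F_hypergraph n ->
  exists (T : finType) (D : rel T),
    is_DPO R D /\ contains_subhypergraph (competition_hypergraph D) H.
Proof.
case=> ->.
- apply: (drawing_realizes R ord0 (P := @draw n)
    (W := codom (@pair_witness n) ++ [:: (0, - (4 * n.+1%:Z))%R])) => //.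
  + exact: draw_inj.
  + exact: above_draw_sparse.
  + move=> e; rewrite map_cat mem_cat -path_edgesE /= above_inner //.
    by rewrite !inE.
- apply: (drawing_realizes R ord0 (P := @draw n)
    (W := codom (@pair_witness n) ++
      [:: (0, - (4 * n.+2%:Z))%R; (-4, - (4 * n.+1%:Z))%R])) => //.
  + exact: draw_inj.
  + exact: above_draw_sparse.
  + move=> e; rewrite map_cat mem_cat -path_edgesE /= above_all_but_first.
    by rewrite above_all_but_last // !inE.
Qed.
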